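(* Let $\mathcal{A}$ and $\mathcal{B}$ be abelian categories, let $(F,G):\mathcal{A}\to\mathcal{B}$ be an adjoint pair (with $F:\mathcal{A}\to\mathcal{B}$ left adjoint to $G:\mathcal{B}\to\mathcal{A}$), and let $\mathcal{Y}\subseteq\mathcal{A}$ and $\mathcal{X}\subseteq\mathcal{B}$ be subcategories. 1. If $FG(\mathcal{X})\subseteq\mathcal{X}$ and $\mathcal{D}\supseteq\mathcal{X}$ is a full subcategory of $\mathcal{B}$ such that $G$ preserves exact sequences in $\mathcal{D}$, then for every $N\in\mathcal{D}$, $$\mathrm{e.l}_{G(\mathcal{X})}\text{-}\dim(G(N))\leq \mathrm{e.l}_{\mathcal{X}}\text{-}\dim(N).$$ 2. If $GF(\mathcal{Y})\subseteq\mathcal{Y}$ and $\mathcal{J}\supseteq\mathcal{Y}$ is a full subcategory of $\mathcal{A}$ such that $F$ preserves exact sequences in $\mathcal{J}$, then for every $M\in\mathcal{J}$, $$\mathrm{e.r}_{F(\mathcal{Y})}\text{-}\dim(F(M))\leq \mathrm{e.r}_{\mathcal{Y}}\text{-}\dim(M).$$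
   Context: ''Subcategory'' means full subcategory closed under isomorphisms and containing the zero object. For a subcategory $\mathcal{X}$, $G(\mathcal{X})$ denotes the subcategory of objects isomorphic to $G(X)$ with $X\in\mathcal{X}$, and similarly for $F(\mathcal{Y})$. ''$G$ preserves exact sequences in $\mathcal{D}$'' means that $G$ sends every exact sequence of $\mathcal{B}$ all of whose terms lie in $\mathcal{D}$ to an exact sequence of $\mathcal{A}$; similarly for $F$ and $\mathcal{J}$. For a subcategory $\mathcal{F}$ of an abelian category, $\mathrm{e.l}_{\mathcal{F}}\text{-}\dim(M)$ (exact left $\mathcal{F}$-dimension) is the least integer $n\geq 0$ for which there is an exact sequence $0\to A_n\to\cdots\to A_0\to M\to 0$ with all $A_i\in\mathcal{F}$, and $\infty$ if there is none. Dually, $\mathrm{e.r}_{\mathcal{F}}\text{-}\dim(M)$ is the least $n\geq 0$ for which there is an exact sequence $0\to M\to A^0\to\cdots\to A^n\to 0$ with all $A^i\in\mathcal{F}$, and $\infty$ if there is none. *)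

(* Defs.v *)
From mathcomp Require Import all_boot all_order all_algebra.
From mathcomp Require Import boolp classical_sets constructive_ereal.

Set Implicit Arguments.
Unset Strict Implicit.
Unset Printing Implicit Defensive.

Import GRing.Theory.

Local Open Scope classical_set_scope.
Local Open Scope ring_scope.

(** ** Abelian categories *)

Record preadditive := Preadditive {
  ob :> Type;
  mor : ob -> ob -> zmodType;
  idm : forall X, mor X X;
  cmp : forall X Y Z, mor Y Z -> mor X Y -> mor X Z;
  cmp1m : forall X Y (f : mor X Y), cmp (idm Y) f = f;
  cmpm1 : forall X Y (f : mor X Y), cmp f (idm X) = f;
  cmpA : forall W X Y Z (h : mor Y Z) (g : mor X Y) (f : mor W X),
    cmp h (cmp g f) = cmp (cmp h g) f;
  cmpDl : forall X Y Z (g1 g2 : mor Y Z) (f : mor X Y),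
    cmp (g1 + g2) f = cmp g1 f + cmp g2 f;
  cmpDr : forall X Y Z (g : mor Y Z) (f1 f2 : mor X Y),
    cmp g (f1 + f2) = cmp g f1 + cmp g f2
}.

Notation "g \co f" := (cmp g f) (at level 40, left associativity).

Section Notions.
Variable C : preadditive.
Implicit Types W X Y Z : C.

Definition isomorphic X Y : Prop :=
  exists (f : mor X Y) (g : mor Y X), g \co f = idm X /\ f \co g = idm Y.

Definition mono X Y (f : mor X Y) : Prop :=
  forall W (g h : mor W X), f \co g = f \co h -> g = h.

Definition epi X Y (f : mor X Y) : Prop :=
  forall Z (g h : mor Y Z), g \co f = h \co f -> g = h.

Definition is_zero Z : Prop :=
  (forall X, exists! f : mor X Z, True) /\ (forall X, exists! f : mor Z X, True).

Definition is_biproduct X Y P (i1 : mor X P) (i2 : mor Y P)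
    (p1 : mor P X) (p2 : mor P Y) : Prop :=
  [/\ p1 \co i1 = idm X, p2 \co i2 = idm Y, p1 \co i2 = 0, p2 \co i1 = 0 &
      i1 \co p1 + i2 \co p2 = idm P].

Definition is_kernel X Y (f : mor X Y) K (k : mor K X) : Prop :=
  f \co k = 0 /\
  forall W (h : mor W X), f \co h = 0 -> exists! u : mor W K, k \co u = h.

Definition is_cokernel X Y (f : mor X Y) Q (q : mor Y Q) : Prop :=
  q \co f = 0 /\
  forall W (h : mor Y W), h \co f = 0 -> exists! u : mor Q W, u \co q = h.

Definition is_image X Y (f : mor X Y) I (i : mor I Y) : Prop :=
  exists (Q : C) (q : mor Y Q), is_cokernel f q /\ is_kernel q i.

(* [X -f-> Y -g-> Z] with Im f = Ker g as subobjects of Y. *)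
Definition exact_at X Y Z (f : mor X Y) (g : mor Y Z) : Prop :=
  exists (I : C) (i : mor I Y), is_image f i /\ is_kernel g i.

Definition is_abelian : Prop :=
  [/\ exists Z : C, is_zero Z,
      forall X Y, exists P (i1 : mor X P) (i2 : mor Y P) p1 p2,
        is_biproduct i1 i2 p1 p2,
      forall X Y (f : mor X Y), exists K (k : mor K X), is_kernel f k,
      forall X Y (f : mor X Y), exists Q (q : mor Y Q), is_cokernel f q &
      (forall X Y (f : mor X Y), mono f ->
         exists Z (g : mor Y Z), is_kernel g f) /\
      (forall X Y (f : mor X Y), epi f ->
         exists Z (g : mor Z X), is_cokernel g f)].

(* The finite sequence E 0 -> ... -> E k.-1 is exact at each of its k - 2
   inner terms.  The values of E from index k on, and of d from index k - 1 on,
   are irrelevant: any k terms extend to such a family by zero objects. *)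
Definition exact_seq (k : nat) (E : nat -> C)
    (d : forall i, mor (E i) (E i.+1)) : Prop :=
  forall i, (i.+2 < k)%N -> exact_at (d i) (d i.+1).

Definition subcategory (S : set C) : Prop :=
  (forall X Y, isomorphic X Y -> S X -> S Y) /\ (exists2 Z, is_zero Z & S Z).

(* 0 -> A_n -> ... -> A_0 -> M -> 0, with A_(n - i) = E i.+1. *)
Definition left_resolution (S : set C) (M : C) (n : nat) : Prop :=
  exists (E : nat -> C) (d : forall i, mor (E i) (E i.+1)),
    [/\ exact_seq n.+4 d, is_zero (E 0%N),
        forall i, (i <= n)%N -> S (E i.+1),
        E n.+2 = M & is_zero (E n.+3)].

(* 0 -> M -> A^0 -> ... -> A^n -> 0, with A^i = E i.+2. *)
Definition right_resolution (S : set C) (M : C) (n : nat) : Prop :=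
  exists (E : nat -> C) (d : forall i, mor (E i) (E i.+1)),
    [/\ exact_seq n.+4 d, is_zero (E 0%N), E 1%N = M,
        forall i, (i <= n)%N -> S (E i.+2) & is_zero (E n.+3)].

End Notions.

Record abelianCategory := AbelianCategory {
  abcat :> preadditive;
  abcatP : is_abelian abcat
}.

(** ** Exact dimensions *)

Definition least (P : nat -> Prop) : \bar int :=
  if pselect (exists n, `[< P n >]) is left exP
  then ((ex_minn exP)%:Z)%:E else +oo%E.

Definition el_dim (C : preadditive) (S : set C) (M : C) : \bar int :=
  least (left_resolution S M).

Definition er_dim (C : preadditive) (S : set C) (M : C) : \bar int :=
  least (right_resolution S M).

(** ** Functors and adjunctions *)

(* Additivity is not required: it is automatic for a functor between abelian
   categories that has an adjoint. *)
Record functor (C D : preadditive) := Functor {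
  fob :> C -> D;
  fmap : forall X Y, mor X Y -> mor (fob X) (fob Y);
  fmap1 : forall X, fmap (idm X) = idm (fob X);
  fmapM : forall X Y Z (g : mor Y Z) (f : mor X Y),
    fmap (g \co f) = fmap g \co fmap f
}.

(* [adjunction F G] : F is left adjoint to G. *)
Record adjunction (C D : preadditive) (F : functor C D) (G : functor D C) :=
Adjunction {
  adj : forall (X : C) (Y : D), mor (F X) Y -> mor X (G Y);
  adj_bij : forall X Y, bijective (@adj X Y);
  adj_natl : forall X X' Y (u : mor X' X) (f : mor (F X) Y),
    adj (f \co fmap F u) = adj f \co u;
  adj_natr : forall X Y Y' (v : mor Y Y') (f : mor (F X) Y),
    adj (v \co f) = fmap G v \co adj f
}.

Definition ess_image (C D : preadditive) (F : functor C D) (S : set C) : set D :=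
  [set Y | exists2 X, S X & isomorphic Y (F X)].

Definition preserves_exact_in (C D : preadditive) (F : functor C D)
    (S : set C) : Prop :=
  forall (k : nat) (E : nat -> C) (d : forall i, mor (E i) (E i.+1)),
    (forall i, (i < k)%N -> S (E i)) -> exact_seq k d ->
    exact_seq k (fun i => fmap F (d i)).

(* Main.v *)
(* Applied termwise, G turns an X-resolution of N, whose terms all lie in D,
   into an exact sequence; being a right adjoint, G also keeps the two end terms
   zero.  So the image is a resolution of G N of the same length; dually for F,
   a left adjoint. *)
Require Import Defs.
From mathcomp Require Import all_boot all_order all_algebra.
From mathcomp Require Import boolp classical_sets constructive_ereal.

Local Open Scope classical_set_scope.

Set Implicit Arguments.
Unset Strict Implicit.
Unset Printing Implicit Defensive.

Import Order.TTheory GRing.Theory Num.Theory.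

Local Open Scope ring_scope.

(** Reduces a comparison of dimensions to transporting a resolution of one fixed length: the least
    witness of [P] is some witness of [Q], and the value is [+oo] when [P] has none. *)
Lemma le_least (P Q : nat -> Prop) :
  (forall n, P n -> Q n) -> (least Q <= least P)%E.
Proof.
move=> PQ; rewrite /least.
case: (pselect (exists n, `[< P n >])) => [exP|_]; last by rewrite leey.
case: pselect => [exQ|[]]; last first.
  by have [n /asboolP /PQ Qn] := exP; exists n; apply/asboolP.
rewrite lee_fin lez_nat.
case: (ex_minnP exQ) => m _ m_min; case: ex_minnP => n /asboolP /PQ Qn _.
exact/m_min/asboolP.
Qed.

Section Preadditive.
Variable C : preadditive.

Lemma cmp0m (X Y Z : C) (f : mor X Y) : (0 : mor Y Z) \co f = 0.
Proof. by apply: (addIr (0 \co f)); rewrite -cmpDl !add0r. Qed.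

Lemma cmpm0 (X Y Z : C) (g : mor Y Z) : g \co (0 : mor X Y) = 0.
Proof. by apply: (addIr (g \co 0)); rewrite -cmpDr !add0r. Qed.

(** Every map into or out of [Z] factors through [idm Z]. A single equation is thus left to check
    for the images under the adjoints. *)
Lemma is_zeroE (Z : C) : is_zero Z <-> idm Z = 0.
Proof.
split=> [[ZT _]|Z0]; first by have [f [_ uf]] := ZT Z; rewrite -(uf (idm Z)) -?(uf 0).
split=> X; exists 0; split=> // f _.
- by rewrite -[f]cmp1m Z0 cmp0m.
- by rewrite -[f]cmpm1 Z0 cmpm0.
Qed.

Lemma isomorphic_refl (X : C) : isomorphic X X.
Proof. by exists (idm X), (idm X); rewrite cmp1m. Qed.

Lemma subcategory_zero (S : set C) (Z : C) : subcategory S -> is_zero Z -> S Z.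
Proof.
move=> [isoS [Z' /is_zeroE Z'0 SZ']] /is_zeroE Z0.
(* The zero maps are mutually inverse, since both identities vanish. *)
by apply: (isoS Z') => //; exists 0, 0; rewrite Z0 Z'0 !cmp0m.
Qed.

End Preadditive.

Lemma ess_image_fob (C D : preadditive) (F : functor C D) (S : set C) (X : C) :
  S X -> ess_image F S (F X).
Proof. by move=> SX; exists X => //; exact: isomorphic_refl. Qed.

Section Adjunction.
Variables (C D : preadditive) (F : functor C D) (G : functor D C).
Variable FG : adjunction F G.

(** Endomorphisms of [G Z] are transposes of maps from [F (G Z)] to the terminal object [Z]; there
    is only one such map, so [idm] and [0] coincide. *)
Lemma right_adjoint_zero (Z : D) : is_zero Z -> is_zero (G Z).
Proof.
move=> [ZT _]; apply/is_zeroE.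
have [g _ gK] := adj_bij FG (G Z) Z; have [f [_ uf]] := ZT (F (G Z)).
by rewrite -(gK (idm _)) -(gK 0) -(uf (g _)) // -(uf (g 0)).
Qed.

Lemma left_adjoint_zero (Z : C) : is_zero Z -> is_zero (F Z).
Proof.
move=> [_ ZI]; apply/is_zeroE.
(* Dually, [idm] and [0] on [F Z] have equal transposes, as [Z] is initial. *)
have [f [_ uf]] := ZI (G (F Z)); apply: (bij_inj (adj_bij FG Z (F Z))).
by rewrite -(uf (adj _ (idm _))) // -(uf (adj _ 0)).
Qed.

End Adjunction.

Section Resolutions.
Variables (C D : preadditive) (F : functor C D) (S T : set C).
Hypothesis F0 : forall Z, is_zero Z -> is_zero (F Z).
Hypotheses (subT : subcategory T) (ST : S `<=` T).
Hypothesis exF : preserves_exact_in F T.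

Lemma left_resolution_fmap (M : C) (n : nat) : T M ->
  left_resolution S M n -> left_resolution (ess_image F S) (F M) n.
Proof.
move=> TM [E [d [exE E0 SE EM EZ]]].
exists (fun i => F (E i)), (fun i => fmap F (d i)); split.
(* All [n.+4] terms must lie in [T]. After [E 0], indices are peeled off from the top: the final
   zero, then [M], then the terms in [S]. *)
- apply: exF exE => -[|i]; first by move=> _; exact: subcategory_zero.
  rewrite !ltnS leq_eqVlt => /predU1P[->|]; first exact: subcategory_zero.
  rewrite ltnS leq_eqVlt => /predU1P[->|]; first by rewrite EM.
  by rewrite ltnS => /SE/ST.
- exact: F0.
- by move=> i /SE; exact: ess_image_fob.
- by rewrite EM.
- exact: F0.
Qed.

Lemma right_resolution_fmap (M : C) (n : nat) : T M ->
  right_resolution S M n -> right_resolution (ess_image F S) (F M) n.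
Proof.
move=> TM [E [d [exE E0 EM SE EZ]]].
exists (fun i => F (E i)), (fun i => fmap F (d i)); split.
(* Here [M] sits at index 1, so only the final zero is split off from the top. *)
- apply: exF exE => -[|[|i]]; first by move=> _; exact: subcategory_zero.
    by rewrite EM.
  rewrite !ltnS leq_eqVlt => /predU1P[->|]; first exact: subcategory_zero.
  by rewrite ltnS => /SE/ST.
- exact: F0.
- by rewrite EM.
- by move=> i /SE; exact: ess_image_fob.
- exact: F0.
Qed.

End Resolutions.

Theorem theorem3p2 (A B : abelianCategory) (F : functor A B) (G : functor B A)
  (FG : adjunction F G) (Y : set A) (X : set B)
  (subY : subcategory Y) (subX : subcategory X) :
  (ess_image F (ess_image G X) `<=` X ->
   forall D : set B, subcategory D -> X `<=` D -> preserves_exact_in G D ->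
   forall N : B, D N -> (el_dim (ess_image G X) (G N) <= el_dim X N)%E)
  /\
  (ess_image G (ess_image F Y) `<=` Y ->
   forall J : set A, subcategory J -> Y `<=` J -> preserves_exact_in F J ->
   forall M : A, J M -> (er_dim (ess_image F Y) (F M) <= er_dim Y M)%E).
Proof.
(* [T] stands for [D] in the first half and for [J] in the second. *)
split=> _ T subT ST exT M TM; apply: le_least => n.
- exact: (left_resolution_fmap (right_adjoint_zero FG) subT ST exT TM).
- exact: (right_resolution_fmap (left_adjoint_zero FG) subT ST exT TM).
Qed.
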